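(* Let $G=(V,E)$ be a locally finite connected weighted graph with measure $\mu$ satisfying $\mu(x)\ge\mu_0>0$ for all $x\in V$, and let $h:V\to\mathbb{R}$ satisfy $h(x)\ge h_0$ for all $x\in V$ for some constant $h_0>0$. Then for all $1<s\le r\le\infty$ the space $W_h^{1,s}(V)$ is continuously embedded into $L^r(V)$, and for all $u\in W_h^{1,s}(V)$ $$\|u\|_\infty\le\frac{1}{h_0^{1/s}\mu_0^{1/s}}\|u\|_{W_h^{1,s}(V)}$$ and $$\|u\|_{L^r(V)}\le\mu_0^{\frac{s-r}{sr}}h_0^{-\frac1s}\|u\|_{W_h^{1,s}(V)}\qquad\text{for all } s\le r<\infty.$$ Furthermore, if also $h(x)\to\infty$ as $\mathrm{dist}(x,x_0)\to\infty$ for some fixed $x_0\in V$, then $W_h^{1,s}(V)$ is compactly embedded into $L^r(V)$ for all $1<s\le r\le\infty$.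
   Context: Graph setting: $G=(V,E)$ is locally finite (each vertex lies on finitely many edges) and connected; each edge $xy\in E$ has a weight $\omega_{xy}=\omega_{yx}>0$; $y\sim x$ means $xy\in E$; $\mathrm{dist}(x,y)$ is the minimal number of edges connecting $x$ and $y$; $\mu:V\to(0,\infty)$. Write $\int_V u\,d\mu=\sum_{x\in V}u(x)\mu(x)$; $L^r(V)$ ($1\le r<\infty$) has norm $\|u\|_{L^r(V)}=(\int_V|u|^rd\mu)^{1/r}$ and $L^\infty(V)$ has norm $\|u\|_\infty=\sup_V|u|$. For $u:V\to\mathbb{R}$, $|\nabla u|(x)=\left(\frac{1}{2\mu(x)}\sum_{y\sim x}\omega_{xy}(u(y)-u(x))^2\right)^{1/2}$. $C_c(V)$ is the set of finitely supported functions on $V$; for $s>1$, $W^{1,s}(V)$ is the completion of $C_c(V)$ under $\left(\int_V|\nabla u|^s+|u|^sd\mu\right)^{1/s}$ (a space of functions on $V$), and $W_h^{1,s}(V)=\{u\in W^{1,s}(V):\int_Vh|u|^sd\mu<\infty\}$ with norm $\|u\|_{W_h^{1,s}(V)}=\left(\int_V|\nabla u|^s+h|u|^sd\mu\right)^{1/s}$. *)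

(* Defs.v *)
From HB Require Import structures.
From mathcomp Require Import all_boot all_order all_algebra.
From mathcomp Require Import all_classical all_reals all_analysis.

Set Implicit Arguments.
Unset Strict Implicit.
Unset Printing Implicit Defensive.

Import Order.TTheory GRing.Theory Num.Theory.
Import numFieldNormedType.Exports.

Local Open Scope classical_set_scope.
Local Open Scope ring_scope.

(* Loops are not excluded; they contribute nothing to the gradient.  Only the
   values of [weight] on edges are meaningful. *)
Record weightedGraph (R : realType) (V : choiceType) := WeightedGraph {
  adj : rel V;
  adj_sym : symmetric adj;
  adj_locally_finite : forall x, finite_set [set y | adj x y];
  adj_connected : forall x y, exists p : seq V, path adj x p /\ last x p = y;
  weight : V -> V -> R;
  weight_sym : forall x y, adj x y -> weight x y = weight y x;
  weight_gt0 : forall x y, adj x y -> 0 < weight x y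
}.

Section Distance.
Context (R : realType) (V : choiceType) (G : weightedGraph R V).

Definition has_walk (x y : V) (n : nat) : bool :=
  `[< exists p : seq V, [/\ path (adj G) x p, last x p = y & size p = n] >].

Lemma has_walk_ex (x y : V) : exists n, has_walk x y n.
Proof.
have [p [xp py]] := adj_connected G x y.
by exists (size p); apply/asboolP; exists p.
Qed.

Definition dist (x y : V) : nat := ex_minn (has_walk_ex x y).

End Distance.

Section Spaces.
Context (R : realType) (V : choiceType) (G : weightedGraph R V) (mu : V -> R).

(* [esum] is the supremum of the finite partial sums, so this is the integral
   of [f] when [f] is nonnegative, the only case in which it is used below. *)
Definition integral_V (f : V -> R) : \bar R :=
  (\esum_(x in [set: V]) (f x * mu x)%:E)%E.

Definition grad (u : V -> R) (x : V) : R :=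
  Num.sqrt ((2 * mu x)^-1 *
            \sum_(y \in [set y | adj G x y]) weight G x y * (u y - u x) ^+ 2).

(* Only the exponents [0 < r <= +oo] are meaningful. *)
Definition Lr_norm (r : \bar R) (u : V -> R) : \bar R :=
  match r with
  | p%:E => (integral_V (fun x => `|u x| `^ p)%R `^ (1 / p)%R)%E
  | +oo%E => ereal_sup [set (`|u x|)%:E | x in [set: V]]
  | -oo%E => 0%E
  end.

Definition Lr_space (r : \bar R) : set (V -> R) :=
  [set u | (Lr_norm r u < +oo)%E].

Definition Cc : set (V -> R) := [set u | finite_set [set x | u x != 0]].

Definition Wh_norm (h : V -> R) (s : R) (u : V -> R) : \bar R :=
  (integral_V (fun x => grad u x `^ s + h x * `|u x| `^ s)%R `^ (1 / s)%R)%E.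

Definition W_norm (s : R) (u : V -> R) : \bar R :=
  (integral_V (fun x => grad u x `^ s + `|u x| `^ s)%R `^ (1 / s)%R)%E.

(* An element of the completion of [Cc] is a class of Cauchy sequences.  As mu
   is positive, such a sequence converges at every vertex, and the class is
   identified with the limit function: a Cauchy sequence tends to 0 in norm if
   and only if it tends to 0 at every vertex. *)
Definition W_space (s : R) : set (V -> R) :=
  [set u | exists phi : nat -> V -> R,
    [/\ forall n, Cc (phi n),
        forall e : R, 0 < e -> exists N : nat, forall m n : nat,
          (N <= m)%N -> (N <= n)%N -> (W_norm s (phi m \- phi n)%R < e%:E)%E
      & forall x, phi n x @[n --> \oo] --> u x]].

Definition Wh_space (h : V -> R) (s : R) : set (V -> R) :=
  [set u | W_space s u /\ (integral_V (fun x => (h x * `|u x| `^ s)%R) < +oo)%E].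

End Spaces.

Section Embeddings.
Context (R : realType) (V : choiceType).
Context (X : set (V -> R)) (normX : (V -> R) -> \bar R).
Context (Y : set (V -> R)) (normY : (V -> R) -> \bar R).

Definition continuously_embedded : Prop :=
  X `<=` Y /\
  exists C : R, 0 < C /\ forall u, X u -> (normY u <= C%:E * normX u)%E.

Definition compactly_embedded : Prop :=
  continuously_embedded /\
  forall u : nat -> V -> R,
    (forall n, X (u n)) ->
    (exists M : R, forall n, (normX (u n) <= M%:E)%E) ->
    exists (k : nat -> nat) (v : V -> R),
      [/\ increasing_seq k, Y v
        & normY (u (k n) \- v)%R @[n --> \oo] --> 0%E].

End Embeddings.

(* Main.v *)
(* Both bounds use only the potential [P u = \int h |u|^s dmu], which the norm
   of [Wh_space] dominates: each single term gives [h0 mu0 |u x|^s <= P u], and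
   [|u|^r = |u|^(r-s) |u|^s] then controls the [L^r] norm.

   For compactness, a sequence with bounded potential has a pointwise limit [v]
   along a nonprincipal ultrafilter.  Outside the finite set [h < K] the mass
   [\int |u n - v|^s dmu] is at most a constant over [K]; inside it, it is small
   for ultrafilter-many [n].  So this mass is arbitrarily small for arbitrarily
   large [n], which yields the subsequence, and the [L^r] bound applied with
   [h = 1] passes from [L^s] to [L^r]. *)

Require Import Defs.
From HB Require Import structures.
From mathcomp Require Import all_boot all_order all_algebra.
From mathcomp Require Import finmap.
From mathcomp Require Import all_classical all_reals all_analysis.
From mathcomp Require Import ring lra.

Set Implicit Arguments.
Unset Strict Implicit.
Unset Printing Implicit Defensive.

Import Order.TTheory GRing.Theory Num.Theory.
Import numFieldNormedType.Exports.

Local Open Scope classical_set_scope.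
Local Open Scope ring_scope.

(** * Real powers and finite sums *)

Lemma powR_interpolation (R : realType) (I h m s r : R) :
    0 <= I -> 0 < h -> 0 < m -> 0 < s -> 0 < r ->
  ((I / (h * m)) `^ ((r - s) / s) * (I / h)) `^ (1 / r) =
  m `^ ((s - r) / (s * r)) * h `^ (- (1 / s)) * I `^ (1 / s).
Proof.
move=> I0 h0 m0 s0 r0.
have [->|In0] := eqVneq I 0.
  by rewrite !mul0r mulr0 !powR0 ?mulr0// div1r invr_eq0 gt_eqF.
have {In0}I0 : 0 < I by rewrite lt0r In0.
(* With each base written as an exponential, the identity only compares exponents, linear in the
   three logarithms. The case [I = 0], where this rewriting fails, is settled above. *)
rewrite -[I]lnK// -[h]lnK// -[m]lnK// -!expRD -!expRN -!expRD -!expRM -!expRD.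
by rewrite -expRM; congr expR; field; rewrite !gt_eqF.
Qed.

(** Finite and infinite exponents share one constant so that a single estimate serves both. The
    value at [-oo] is a default, excluded later by [s%:E <= r]. *)
Definition Lr_const (R : realType) (mu0 h0 s : R) (r : \bar R) : R :=
  if r is p%:E then mu0 `^ ((s - p) / (s * p)) * h0 `^ (- (1 / s))
  else 1 / (h0 `^ (1 / s) * mu0 `^ (1 / s)).

Lemma Lr_const_gt0 (R : realType) (mu0 h0 s : R) (r : \bar R) :
  0 < mu0 -> 0 < h0 -> 0 < Lr_const mu0 h0 s r.
Proof.
move=> mu0_gt0 h0_gt0.
by case: r => [r| |]; rewrite /Lr_const ?div1r ?invr_gt0 mulr_gt0 ?powR_gt0.
Qed.

Lemma ler_fsum (R : realDomainType) (I : choiceType) (A : set I)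
    (f g : I -> R) : finite_set A -> (forall i, A i -> f i <= g i) ->
  \sum_(i \in A) f i <= \sum_(i \in A) g i.
Proof.
move=> Afin fg; rewrite -lee_fin -!fsumEFin//.
by apply: lee_fsum => // i Ai; rewrite lee_fin fg.
Qed.

Lemma ler_fsum_subset (R : realDomainType) (I : choiceType) (A B : set I)
    (f : I -> R) : finite_set B -> A `<=` B -> (forall i, 0 <= f i) ->
  \sum_(i \in A) f i <= \sum_(i \in B) f i.
Proof.
move=> Bfin AB f0; have Afin := sub_finite_set AB Bfin.
rewrite -lee_fin -!fsumEFin//; apply: lee_fsum_nneg_subset => //.
  by move=> x; rewrite !inE => /AB.
by move=> x _; rewrite lee_fin.
Qed.

Lemma powR_rootK (R : realType) (a s : R) : 0 < s -> 0 <= a ->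
  (a `^ (1 / s)) `^ s = a.
Proof.
by move=> s0 a0; rewrite -powRrM div1r mulVf ?powRr1// gt_eqF.
Qed.

Lemma root_powRK (R : realType) (a s : R) : 0 < s -> 0 <= a ->
  (a `^ s) `^ (1 / s) = a.
Proof.
by move=> s0 a0; rewrite -powRrM div1r mulfV ?powRr1// gt_eqF.
Qed.

Lemma ler_powR_norm (R : realType) (s a b : R) : 0 <= s -> `|a| <= b ->
  `|a| `^ s <= b `^ s.
Proof.
move=> s0 ab; apply: ge0_ler_powR => //; rewrite nnegrE//.
exact: le_trans ab.
Qed.

(** |a - b| is at most twice the larger of |a| and |b|. This crude substitute for a convexity
    inequality suffices, since only boundedness of the potential of a difference matters later. *)
Lemma powR_norm_sub_le (R : realType) (s a b : R) : 0 <= s ->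
  `|a - b| `^ s <= 2 `^ s * (`|a| `^ s + `|b| `^ s).
Proof.
move=> s0.
wlog ab : a b / `|a| <= `|b|.
  move=> H; have [/H//|/ltW/H] := leP `|a| `|b|.
  by rewrite distrC (addrC (`|a| `^ s)).
have : `|a - b| <= 2 * `|b|.
  by rewrite (le_trans (ler_normB _ _))// mulr_natl mulr2n lerD2r.
move/(ler_powR_norm s0)/le_trans; apply.
by rewrite powRM// ler_wpM2l ?powR_ge0// lerDr powR_ge0.
Qed.

(** * Bounds by the potential *)

Section potential.
Context {R : realType} {V : choiceType} (mu : V -> R).

Lemma integral_V_leP (f : V -> R) (M : R) :
  (integral_V mu f <= M%:E)%E <->
  (forall A, finite_set A -> \sum_(x \in A) f x * mu x <= M).
Proof.
split=> [fM A Afin|fM].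
  rewrite -lee_fin -fsumEFin//; apply: le_trans fM.
  by apply: ereal_sup_ubound; exists A.
apply: ge_ereal_sup => _ [A [Afin _] <-].
by rewrite fsumEFin// lee_fin fM.
Qed.

(** The empty partial sum enters the supremum, whatever the sign of [f]. *)
Lemma integral_V_ge0 (f : V -> R) : (0 <= integral_V mu f)%E.
Proof.
by apply: ereal_sup_ubound; exists set0; rewrite ?fsbig_set0//; exact: fsets_set0.
Qed.

Context {mu0 : R} (mu0_gt0 : 0 < mu0) (mu_ge : forall x, mu0 <= mu x).

Let mu_gt0 x : 0 < mu x. Proof. exact: lt_le_trans (mu_ge x). Qed.

Lemma le_integral_V (f g : V -> R) : (forall x, f x <= g x) ->
  (integral_V mu f <= integral_V mu g)%E.
Proof.
by move=> fg; apply: le_esum => x _; rewrite lee_fin ler_wpM2r// ltW.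
Qed.

Definition potential (h : V -> R) (s : R) (u : V -> R) : \bar R :=
  integral_V mu (fun x => h x * `|u x| `^ s).

Section bounds.
Context (h : V -> R) (h0 : R) (h0_gt0 : 0 < h0) (h_ge : forall x, h0 <= h x).
Context (s : R) (s_gt0 : 0 < s).

Let h_ge0 x : 0 <= h x. Proof. exact: le_trans (ltW h0_gt0) (h_ge x). Qed.

Lemma potential_pointwise (u : V -> R) (I : R) (x : V) :
  (potential h s u <= I%:E)%E -> `|u x| <= (I / (h0 * mu0)) `^ (1 / s).
Proof.
move=> /integral_V_leP/(_ [set x] (finite_set1 x)); rewrite fsbig_set1 => uI.
rewrite -(root_powRK s_gt0 (normr_ge0 (u x))).
have H : `|u x| `^ s <= I / (h0 * mu0).
  rewrite ler_pdivlMr ?mulr_gt0//; apply: le_trans uI.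
  rewrite mulrC mulrAC.
  by rewrite !ler_pM ?mulr_ge0 ?powR_ge0// ltW.
have C0 := le_trans (powR_ge0 _ _) H.
apply: ge0_ler_powR; rewrite ?nnegrE ?powR_ge0//.
by rewrite divr_ge0// ltW.
Qed.

Lemma integral_V_powR_le (u : V -> R) (I r : R) : s <= r ->
  (potential h s u <= I%:E)%E ->
  (integral_V mu (fun x => `|u x| `^ r)%R <=
     ((I / (h0 * mu0)) `^ ((r - s) / s) * (I / h0))%:E)%E.
Proof.
move=> sr uI; apply/integral_V_leP => A Afin.
have I0 : 0 <= I by rewrite -lee_fin (le_trans _ uI)// integral_V_ge0.
have C0 : 0 <= I / (h0 * mu0) by rewrite divr_ge0// mulr_ge0// ltW.
set C := (I / _) in C0 *.
have : \sum_(x \in A) `|u x| `^ r * mu x <=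
    \sum_(x \in A) C `^ ((r - s) / s) * h0^-1 * (h x * `|u x| `^ s * mu x).
  apply: ler_fsum => // x _.
  rewrite -[r in leLHS](subrK s) powRD; last first.
    by rewrite subrK; apply/implyP; rewrite gt_eqF// (lt_le_trans s_gt0).
  rewrite !mulrA ler_wpM2r ?(ltW (mu_gt0 x))// ler_wpM2r ?powR_ge0//.
  (* |u x| is at most the s-th root of [C], which bounds the factor with exponent [r - s]; the
     inequality 1 <= h x / h0 then inserts the weight. *)
  rewrite -[leLHS]mulr1 -mulrA ler_pM ?powR_ge0//.
    rewrite [_ / s]mulrC -[s^-1]div1r powRrM.
    apply: ler_powR_norm; rewrite ?subr_ge0//.
    exact: potential_pointwise.
  by rewrite ler_pdivlMl// mulr1.
move/le_trans; apply; rewrite -mulr_fsumr -mulrA ler_wpM2l ?powR_ge0//.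
rewrite mulrC ler_wpM2r ?invr_ge0 ?(ltW h0_gt0)//.
exact: (integral_V_leP _ _).1 uI A Afin.
Qed.

(** Stated for the potential rather than the full norm, because compactness also applies it with
    weight 1 to differences [u n \- v], whose gradient is not estimated. *)
Lemma Lr_norm_le_potential (r : \bar R) (u : V -> R) : (s%:E <= r)%E ->
  (Lr_norm mu r u <= (Lr_const mu0 h0 s r)%:E * potential h s u `^ (1 / s)%R)%E.
Proof.
move=> sr; have s1 : 0 < 1 / s by rewrite divr_gt0.
have [] := leP +oo%E (potential h s u).
  rewrite leye_eq => /eqP ->; rewrite poweRyr ?gt_eqF// gt0_muley ?leey//.
  by rewrite lte_fin Lr_const_gt0.
have : (0 <= potential h s u)%E by exact: integral_V_ge0.
case EI : (potential h s u) => [I| |]// I0 _; rewrite lee_fin in I0.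
rewrite poweR_EFin -EFinM.
have uI : (potential h s u <= I%:E)%E by rewrite EI.
case: r sr => [r| |//] sr /=.
  have r0 : 0 < r by rewrite (lt_le_trans s_gt0).
  (* Read backwards, the identity exhibits the right-hand side as the r-th root of the bound in
     [integral_V_powR_le]. *)
  rewrite -powR_interpolation// -poweR_EFin; apply: gt0_ler_poweR.
  - by rewrite divr_ge0// ltW.
  - by rewrite in_itv/= leey integral_V_ge0.
  - rewrite in_itv/= leey andbT lee_fin mulr_ge0 ?powR_ge0// divr_ge0//.
    exact: ltW.
  - exact: integral_V_powR_le.
apply: ge_ereal_sup => _ [x _ <-]; rewrite lee_fin.
apply: le_trans (potential_pointwise x uI) _.
rewrite powRM ?invr_ge0 ?mulr_ge0 ?(ltW h0_gt0) ?(ltW mu0_gt0)//.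
rewrite mulrC ler_wpM2r ?powR_ge0// !div1r -powRM ?(ltW h0_gt0) ?(ltW mu0_gt0)//.
by rewrite -(powR_inv1 (ltW (mulr_gt0 h0_gt0 mu0_gt0))) powRAC powR_inv1 ?powR_ge0.
Qed.

End bounds.

Lemma potential_le_Wh_norm (G : weightedGraph R V) (h : V -> R) (s : R)
    (u : V -> R) : 0 < s ->
  (potential h s u `^ (1 / s)%R <= Wh_norm G mu h s u)%E.
Proof.
move=> s0; apply: gt0_ler_poweR.
- by rewrite divr_ge0// ltW.
- by rewrite in_itv/= leey integral_V_ge0.
- by rewrite in_itv/= leey integral_V_ge0.
- by apply: le_integral_V => x; rewrite lerDr powR_ge0.
Qed.

End potential.

(** * Limits along an ultrafilter *)

Lemma bounded_ultra_limit (R : realType) (U : set_system nat) (a : nat -> R)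
    (c : R) : UltraFilter U -> (forall n, `|a n| <= c) ->
  exists l, forall e, 0 < e -> U [set n | `|l - a n| < e].
Proof.
move=> UU ac.
have Uc : (a @ U) [set` `[- c, c]].
  by apply: (@filterE _ U) => n; rewrite /= in_itv/= -ler_norml.
(* Compactness gives a cluster point [l]. If the indices with |l - a n| < e were not in [U], their
   complement would be, and its image misses the ball of radius [e] at [l]. *)
have [l [_ cl]] := @segment_compact R (- c) c (a @ U) _ Uc.
exists l => e e0.
have [//|Ue] := in_ultra_setVsetC [set n | `|l - a n| < e] UU.
have [] := cl [set y | ~ `|l - y| < e] (ball l e) Ue (nbhsx_ballx _ _ e0).
by move=> y [/= + ly]; rewrite -ball_normE in ly.
Qed.

Lemma filter_finite_forall (T I : choiceType) (U : set_system T) (A : set I)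
    (P : I -> set T) : Filter U -> finite_set A ->
  (forall x, A x -> U (P x)) -> U [set t | forall x, A x -> P x t].
Proof.
move=> FU Afin AP; have := @filter_bigI T I (fset_set A) P U FU.
have PU x : x \in fset_set A -> U (P x) by rewrite in_fset_set// inE => /AP.
move=> /(_ PU); apply: filterS => t Pt x Ax.
by apply: Pt; rewrite /= in_fset_set// inE.
Qed.

(** * Subsequences converging in L^r *)

Section compactness.
Context {R : realType} {V : choiceType} (mu : V -> R) (mu0 : R).
Context (mu0_gt0 : 0 < mu0) (mu_ge : forall x, mu0 <= mu x).
Context (h : V -> R) (h0 : R) (h0_gt0 : 0 < h0) (h_ge : forall x, h0 <= h x).
Context (s : R) (s_gt0 : 0 < s).

Let mu_ge0 x : 0 <= mu x. Proof. exact: le_trans (ltW mu0_gt0) (mu_ge x). Qed.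
Let h_ge0 x : 0 <= h x. Proof. exact: le_trans (ltW h0_gt0) (h_ge x). Qed.

Lemma potential_sub_le (u v : V -> R) (I J : R) :
  (potential mu h s u <= I%:E)%E -> (potential mu h s v <= J%:E)%E ->
  (potential mu h s (u \- v)%R <= (2 `^ s * (I + J))%:E)%E.
Proof.
move=> /integral_V_leP uI /integral_V_leP vJ; apply/integral_V_leP => A Afin.
have : \sum_(x \in A) h x * `|(u \- v) x| `^ s * mu x <=
    \sum_(x \in A) 2 `^ s * (h x * `|u x| `^ s * mu x + h x * `|v x| `^ s * mu x).
  apply: ler_fsum => // x _; rewrite -mulrDl -mulrDr !mulrA ler_wpM2r//.
  by rewrite [_ * h x]mulrC -mulrA ler_wpM2l// powR_norm_sub_le// ltW.
move/le_trans; apply; rewrite -mulr_fsumr ler_wpM2l ?powR_ge0//.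
by rewrite fsbig_split//= lerD ?uI ?vJ.
Qed.

(* Only a comparison [|v x| <= 2 |u n x|] on finite sets is needed here, at the
   price of the factor [2 `^ s]. *)
Lemma potential_ultra_limit_le (U : set_system nat) (u : nat -> V -> R)
    (v : V -> R) (I : R) : UltraFilter U ->
  (forall n, (potential mu h s (u n) <= I%:E)%E) ->
  (forall x e, 0 < e -> U [set n | `|v x - u n x| < e]) ->
  (potential mu h s v <= (2 `^ s * I)%:E)%E.
Proof.
move=> UU uI uv; apply/integral_V_leP => A Afin.
have [n nA] : exists n, forall x, A x -> `|v x| <= 2 * `|u n x|.
  apply: (@filter_ex _ U); apply: filter_finite_forall => // x _.
  (* The tolerance |v x| / 2 yields the comparison; it is not positive when [v x = 0], but the
     comparison is then trivial. *)
  have [v0|v0] := eqVneq (v x) 0.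
    by apply: filterE => n; rewrite v0 normr0 mulr_ge0.
  have v2 : 0 < `|v x| / 2 by rewrite divr_gt0// normr_gt0.
  apply: filterS (uv x _ v2) => n /= vu.
  have := lerB_dist (v x) (u n x); lra.
have /integral_V_leP/(_ A Afin) := uI n.
rewrite -(ler_pM2l (powR_gt0 s (ltr0n R 2))).
apply: le_trans; rewrite mulr_fsumr; apply: ler_fsum => // x Ax.
rewrite !mulrA ler_wpM2r// [_ * h x]mulrC -mulrA ler_wpM2l// -powRM//.
exact: ler_powR_norm (ltW s_gt0) (nA x Ax).
Qed.

(** On the sublevel set the values are at most [d] and the measure at most [S]; off it, a Chebyshev
    estimate with [K <= h x] gives [D / K]. *)
Lemma integral_V_sublevel_split_le (w : V -> R) (D K d S : R) : 0 < K -> 0 <= d ->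
  (potential mu h s w <= D%:E)%E -> finite_set [set x | h x < K] ->
  \sum_(x \in [set x | h x < K]) mu x <= S ->
  (forall x, h x < K -> `|w x| <= d) ->
  (integral_V mu (fun x => `|w x| `^ s)%R <= (d `^ s * S + D / K)%:E)%E.
Proof.
move=> K0 d0 wD Bfin BS wd; apply/integral_V_leP => A Afin.
rewrite (fsbigID [set x | h x < K])//= lerD//.
  have : \sum_(x \in A `&` [set x | h x < K]) `|w x| `^ s * mu x <=
      \sum_(x \in A `&` [set x | h x < K]) d `^ s * mu x.
    apply: ler_fsum; first exact: finite_setIl.
    by move=> x [_ /= hx]; rewrite ler_wpM2r// ler_powR_norm ?(ltW s_gt0)// wd.
  move/le_trans; apply; rewrite -mulr_fsumr ler_wpM2l ?powR_ge0//.
  exact: le_trans (ler_fsum_subset Bfin (@subIsetr _ _ _) mu_ge0) BS.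
have AfinC : finite_set (A `&` ~` [set x | h x < K]) by exact: finite_setIl.
move/integral_V_leP/(_ _ AfinC) : wD; rewrite ler_pdivlMr//; apply: le_trans.
rewrite mulr_fsuml; apply: ler_fsum => // x [_ /= /negP]; rewrite -leNgt => hx.
by rewrite mulrAC ler_wpM2r// mulrC ler_wpM2r ?powR_ge0.
Qed.

Context (h_coercive : forall K, finite_set [set x | h x < K]).

Lemma potential_bounded_cluster (u : nat -> V -> R) (I : R) :
  (forall n, (potential mu h s (u n) <= I%:E)%E) ->
  exists v, (potential mu h s v < +oo)%E /\
    forall e (N : nat), 0 < e -> exists n, (N <= n)%N /\
      (integral_V mu (fun x => `|(u n \- v)%R x| `^ s)%R <= e%:E)%E.
Proof.
(* [U] refines the filter at infinity, so its members contain arbitrarily large indices. *)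
move=> uI; have [U [UU ooU]] := @ultraFilterLemma nat \oo _.
have /choice[v uv] : forall x, exists l, forall e, 0 < e ->
    U [set n | `|l - u n x| < e].
  move=> x; apply: bounded_ultra_limit => n.
  exact: (potential_pointwise mu0_gt0 mu_ge h0_gt0 h_ge s_gt0 x (uI n)).
have vI := potential_ultra_limit_le UU uI uv.
exists v; split=> [|e N e0]; first by rewrite (le_lt_trans vI)// ltry.
have I0 : 0 <= I.
  by rewrite -lee_fin (le_trans _ (uI 0%N))// integral_V_ge0.
set D := 2 `^ s * (I + 2 `^ s * I).
have D0 : 0 <= D by rewrite mulr_ge0 ?addr_ge0 ?mulr_ge0 ?powR_ge0.
(* Chosen so that [D / K] is at most [e / 2]; the summand 1 keeps [K] positive when [D] is 0. *)
pose K := 2 * D / e + 1.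
have K0 : 0 < K by rewrite ltr_wpDl// divr_ge0 ?(ltW e0)// mulr_ge0.
set S := \sum_(x \in [set x | h x < K]) mu x.
have S0 : 0 <= S by apply: fsumr_ge0 => x _.
(* Chosen so that the sublevel term is at most [e / 2]; dividing by [1 + S] also covers an empty
   sublevel set. *)
pose d := (e / 2 / (1 + S)) `^ (1 / s).
have S1 : 0 < 1 + S by rewrite ltr_pwDl.
have d0 : 0 < d by rewrite powR_gt0// !divr_gt0.
have [n [Nn nB]] : exists n, (N <= n)%N /\
    forall x, h x < K -> `|v x - u n x| < d.
  apply: (@filter_ex _ U); apply: filterI; first exact/ooU/nbhs_infty_ge.
  by apply: filter_finite_forall (h_coercive K) _ => x _; exact: uv.
exists n; split=> //.
have wd x : h x < K -> `|(u n \- v) x| <= d.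
  by move=> /nB/ltW; rewrite distrC.
have := integral_V_sublevel_split_le K0 (ltW d0) (potential_sub_le (uI n) vI)
  (h_coercive K) (lexx S) wd.
move/le_trans; apply; rewrite lee_fin -/D powR_rootK//; last first.
  by rewrite ltW// !divr_gt0.
have H1 : e / 2 / (1 + S) * S <= e / 2.
  by rewrite mulrAC ler_pdivrMr// ler_wpM2l ?divr_ge0 ?(ltW e0)// lerDr.
have H2 : D / K <= e / 2.
  rewrite ler_pdivrMr// /K mulrDr mulr1.
  have -> : e / 2 * (2 * D / e) = D by field; rewrite gt_eqF.
  by rewrite lerDl divr_ge0// ltW.
lra.
Qed.

(* The vertex [x0] is needed because the [L^oo] norm is the supremum of the empty
   set, hence [-oo], when [V] is empty. *)
Lemma Lr_norm_subseq_cvg (x0 : V) (u : nat -> V -> R) (I : R) (r : \bar R) :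
  (s%:E <= r)%E -> (forall n, (potential mu h s (u n) <= I%:E)%E) ->
  exists (k : nat -> nat) (v : V -> R), [/\ increasing_seq k, Lr_space mu r v
    & Lr_norm mu r (u (k n) \- v)%R @[n --> \oo] --> 0%E].
Proof.
move=> sr uI; have [v [vfin uv]] := potential_bounded_cluster uI.
have freq N e : 0 < e -> exists n, (N <= n)%N /\
    (Lr_norm mu r (u n \- v)%R <= e%:E)%E.
  move=> e0; pose C := Lr_const mu0 1 s r.
  have C0 : 0 < C by exact: Lr_const_gt0.
  (* [C] times the s-th root of this threshold is exactly [e]. *)
  have [n [Nn un]] := uv ((e / C) `^ s) N (powR_gt0 _ (divr_gt0 e0 C0)).
  exists n; split=> //.
  have H := Lr_norm_le_potential mu0_gt0 mu_ge ltr01 (fun=> lexx 1) s_gt0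
    (u n \- v) sr.
  apply: le_trans H _; rewrite -/C.
  have -> : e%:E = (C%:E * ((e / C) `^ s `^ (1 / s))%:E)%E.
    rewrite -EFinM root_powRK ?(ltW (divr_gt0 _ _))//.
    by rewrite mulrC divfK// gt_eqF.
  rewrite lee_wpmul2l ?lee_fin ?(ltW C0)// -poweR_EFin.
  apply: gt0_ler_poweR.
  - by rewrite divr_ge0// ltW.
  - by rewrite in_itv/= leey integral_V_ge0.
  - by rewrite in_itv/= leey lee_fin powR_ge0.
  - apply: le_trans un; rewrite /potential.
    by under eq_fun do rewrite mul1r.
have /choice[f fP] : forall Nm : nat * nat, exists n, (Nm.1 <= n)%N /\
    (Lr_norm mu r (u n \- v)%R <= (Nm.2.+1%:R^-1)%:E)%E.
  by move=> [N m]; apply: freq; rewrite invr_gt0.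
(* The first argument of [f] forces strict increase; the second makes the error at [k n] at most 1 /
   (n + 1). *)
pose k := fix k n := if n is m.+1 then f ((k m).+1, m.+1) else f (0%N, 0%N).
exists k, v; split.
- by apply/increasing_seqP => n; exact: (fP ((k n).+1, n.+1)).1.
- rewrite /Lr_space/= (le_lt_trans (Lr_norm_le_potential mu0_gt0 mu_ge h0_gt0
    h_ge s_gt0 _ sr))//.
  by rewrite lte_mul_pinfty ?poweR_lty// lee_fin ltW// Lr_const_gt0.
- apply: (@squeeze_cvge _ _ _ _ (cst 0%E) _ (fun n => (n.+1%:R^-1)%:E)).
  + apply: nearW => n; apply/andP; split; last first.
      by case: n => [|n]; [exact: (fP (0%N, 0%N)).2|exact: (fP (_, n.+1)).2].
    case: (r) => [p| |]//=; first exact: poweR_ge0.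
    apply: ereal_sup_ge; exists (`|(u (k n) \- v)%R x0|)%:E; first by exists x0.
    by rewrite lee_fin.
  + exact: cvg_cst.
  + by apply: cvg_EFin; [exact: nearW|exact: cvg_harmonic].
Qed.

End compactness.

(** * Finite balls and assembly of the embeddings *)

Lemma finite_ball (R : realType) (V : choiceType) (G : weightedGraph R V)
    (x0 : V) (N : nat) : finite_set [set x | (dist G x x0 < N)%N].
Proof.
have walk_fin n : finite_set [set x | has_walk G x x0 n].
  elim: n => [|n IHn].
    apply: sub_finite_set (finite_set1 x0) => x /asboolP[p [_ + /size0nil p0]].
    by rewrite p0.
  (* A walk of length n + 1 to [x0] first steps to some [y] with a walk of length n; by symmetry its
     start lies in the finite neighbourhood of [y]. *)
  apply: sub_finite_set
    (bigcup_finite IHn (fun y _ => adj_locally_finite G y)) => x.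
  move=> /asboolP[[|y p] []//= /andP[xy yp] px0 [sp]].
  by exists y; rewrite /= 1?adj_sym//; apply/asboolP; exists p.
apply: sub_finite_set (bigcup_finite (finite_II N) (fun n _ => walk_fin n)) => x.
by rewrite /= /dist; case: ex_minnP => n xn _ nN; exists n.
Qed.

Theorem lemma2p1 (R : realType) (V : choiceType) (G : weightedGraph R V)
    (mu : V -> R) (mu0 : R) (mu0_gt0 : 0 < mu0) (mu_ge : forall x, mu0 <= mu x)
    (h : V -> R) (h0 : R) (h0_gt0 : 0 < h0) (h_ge : forall x, h0 <= h x) :
  [/\ forall (s : R) (r : \bar R), 1 < s -> (s%:E <= r)%E ->
        continuously_embedded (Wh_space G mu h s) (Wh_norm G mu h s)
                              (Lr_space mu r) (Lr_norm mu r),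
      forall (s : R) (u : V -> R), 1 < s -> Wh_space G mu h s u ->
        (Lr_norm mu +oo u <=
           (1 / (h0 `^ (1 / s) * mu0 `^ (1 / s)))%:E * Wh_norm G mu h s u)%E,
      forall (s r : R) (u : V -> R), 1 < s -> s <= r -> Wh_space G mu h s u ->
        (Lr_norm mu r%:E u <=
           (mu0 `^ ((s - r) / (s * r)) * h0 `^ (- (1 / s)))%:E *
           Wh_norm G mu h s u)%E
    & forall x0 : V,
        (forall M : R, exists N : nat, forall x : V,
           (N <= dist G x x0)%N -> M <= h x) ->
        forall (s : R) (r : \bar R), 1 < s -> (s%:E <= r)%E ->
          compactly_embedded (Wh_space G mu h s) (Wh_norm G mu h s)
                             (Lr_space mu r) (Lr_norm mu r)].
Proof.
have s_gt0 (s : R) : 1 < s -> 0 < s by exact: lt_trans.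
have bound s r u : 1 < s -> (s%:E <= r)%E ->
    (Lr_norm mu r u <= (Lr_const mu0 h0 s r)%:E * Wh_norm G mu h s u)%E.
  move=> /s_gt0 s0 sr.
  apply: le_trans (Lr_norm_le_potential mu0_gt0 mu_ge h0_gt0 h_ge s0 u sr) _.
  rewrite lee_wpmul2l ?lee_fin ?(ltW (Lr_const_gt0 s r mu0_gt0 h0_gt0))//.
  exact: (potential_le_Wh_norm mu0_gt0 mu_ge).
have embed s r : 1 < s -> (s%:E <= r)%E ->
    continuously_embedded (Wh_space G mu h s) (Wh_norm G mu h s)
                          (Lr_space mu r) (Lr_norm mu r).
  move=> s1 sr; have s0 := s_gt0 _ s1; split=> [u [_ ufin]|]; last first.
    exists (Lr_const mu0 h0 s r); split=> [|u _]; first exact: Lr_const_gt0.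
    exact: bound.
  (* Membership is read off the potential, whose finiteness is part of [Wh_space]. *)
  apply: le_lt_trans (Lr_norm_le_potential mu0_gt0 mu_ge h0_gt0 h_ge s0 u sr) _.
  by rewrite lte_mul_pinfty ?poweR_lty// lee_fin ltW// Lr_const_gt0.
split=> //.
- by move=> s u s1 _; apply: bound => //; rewrite leey.
- by move=> s r u s1 sr _; exact: bound.
move=> x0 h_infty s r s1 sr; have s0 := s_gt0 _ s1.
split=> [|u _ [M uM]]; first exact: embed.
have h_coercive K : finite_set [set x | h x < K].
  have [N hN] := h_infty K; apply: sub_finite_set (finite_ball G x0 N) => x /=.
  by rewrite ltNge ltnNge; apply: contra => /hN.
(* The norm bound [M] controls the s-th root of the potential, hence [M] to the power [s] bounds the
   potential itself. *)
apply: (Lr_norm_subseq_cvg mu0_gt0 mu_ge h0_gt0 h_ge s0 h_coercive x0 (I := M `^ s)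
  sr) => n.
have pM := le_trans (potential_le_Wh_norm mu0_gt0 mu_ge G h (u n) s0) (uM n).
have p0 : (0 <= potential mu h s (u n))%E by exact: integral_V_ge0.
have := gt0_ler_poweR (ltW s0) _ _ pM.
rewrite -poweRrM div1r mulVf ?gt_eqF// poweRe1// poweR_EFin; apply.
- by rewrite in_itv/= leey poweR_ge0.
- by rewrite in_itv/= leey andbT (le_trans _ pM)// poweR_ge0.
Qed.
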